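(* Let $C\subseteq M_n^+$ be a closed convex cone, let $\rho\in M_n^+$ be a mixed quantum state, and let $P$ be the orthogonal projection onto $\mathrm{range}(\rho)$. The following are equivalent: (a) $D_C(\rho)=1$. (b) $\rho$ is Birkhoff--James orthogonal in the trace norm to every member of $C$. (c) $\operatorname{Tr}(P\sigma)\le 1/2$ for every mixed quantum state $\sigma\in C$.
   Context: $M_n^+$ is the set of $n\times n$ complex (Hermitian) positive semidefinite matrices. A mixed quantum state is a positive semidefinite matrix of trace $1$. A closed convex cone is a nonempty closed convex set that is closed under multiplication by nonnegative real scalars (so it contains $0$). The trace norm $\|A\|_{\mathrm{tr}}$ is the sum of the singular values of $A$. The modified trace distance of $C$ is $$D_C(\rho) = \min\{\|\rho - X\|_{\mathrm{tr}} : X\in C\}.$$ For Hermitian $A,B$ of the same size, $A$ is Birkhoff--James orthogonal to $B$ (in the trace norm) if $\|A\|_{\mathrm{tr}} \le \|A+\lambda B\|_{\mathrm{tr}}$ for all $\lambda\in\mathbb{R}$. *)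

(* Defs.v *)
From HB Require Import structures.
From mathcomp Require Import all_boot all_order all_algebra.
From mathcomp Require Import sesquilinear spectral.
From mathcomp Require Import all_classical all_reals all_analysis.
From mathcomp Require Import complex.

Set Implicit Arguments.
Unset Strict Implicit.
Unset Printing Implicit Defensive.

Import Order.TTheory GRing.Theory Num.Theory.

Local Open Scope classical_set_scope.
Local Open Scope ring_scope.
Local Open Scope complex_scope.
Local Open Scope sesquilinear_scope.

(* The complex numbers are R[i] for R : realType.  The order on R[i] is the
   partial one: x <= y means that Im x = Im y and Re x <= Re y, so that 0 <= x
   also asserts that x is real. *)

Section Defs.
Variables (R : realType) (n : nat).
Implicit Types (A B X P rho sigma : 'M[R[i]]_n) (C : set 'M[R[i]]_n).

Definition psd : set 'M[R[i]]_n :=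
  [set A | A \is hermsymmx /\
           forall v : 'cV[R[i]]_n, 0 <= (v^t* *m A *m v) 0 0].

Definition mixed_state rho : Prop := psd rho /\ \tr rho = 1.

(* The matrix A^* A is Hermitian, hence normal, so that spectral_diag lists its
   eigenvalues with multiplicity; they are nonnegative reals. *)
Definition singular_value A (i : 'I_n) : R :=
  Num.sqrt (complex.Re (spectral_diag (A^t* *m A) 0 i)).

Definition trnorm A : R := \sum_(i < n) singular_value A i.

(* The topology on R[i] is the one given by the modulus; the library attaches
   it to the alias R[i]^o.  The scalars in convex_set are the l : R[i] with
   0 <= l <= 1, that is, the reals of [0, 1]. *)
Definition closed_convex_cone C : Prop :=
  [/\ C !=set0,
      closed (C : set 'M[R[i]^o]_n),
      convex_set C &
      forall (t : R) A, 0 <= t -> C A -> C (t%:C *: A)].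

(* The minimum of a set of reals is its element that is also a lower bound;
   the default -1 is returned if there is none, and is never the minimum of a
   set of trace norms. *)
Definition mod_trace_dist C rho : R :=
  let S := [set trnorm (rho - X) | X in C] in xget (- 1) (S `&` lbound S).

Definition BJ_orthogonal A B : Prop :=
  forall lambda : R, trnorm A <= trnorm (A + lambda%:C *: B).

(* Subspaces are row spaces in the library and proj_ortho acts on row vectors
   from the right, whereas the range of A is its column space. *)
Definition range_proj A : 'M[R[i]]_n := (proj_ortho A^T)^T.

Lemma range_proj_idem A : range_proj A *m range_proj A = range_proj A.
Proof. by rewrite /range_proj -trmx_mul proj_ortho_proj. Qed.

Lemma range_proj_range A : ((range_proj A)^T :=: A^T)%MS.
Proof. by rewrite /range_proj trmxK; apply: proj_orthoE. Qed.

Lemma range_proj_herm A : range_proj A \is hermsymmx.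
Proof.
set Q := proj_ortho A^T.
have compl : (1%:M - Q) *m (Q^t*) = 0.
  apply/eqP; rewrite -orthomx1E.
  have sQA : (Q <= A^T)%MS by have := proj_ortho_sub A^T 1%:M; rewrite mul1mx.
  have := proj_ortho_compl_sub A^T 1%:M; rewrite mul1mx => s1Q.
  apply: submx_trans s1Q _.
  by rewrite submx_ortho.
have QQ : (Q^t*) = Q *m (Q^t*).
  by move/eqP: compl; rewrite mulmxBl mul1mx subr_eq0 => /eqP.
have QE : (Q^t*) = Q.
  move: (Q) QQ => M MM.
  by rewrite -[RHS]trmxCK {2}MM trmx_mul map_mxM trmxCK -MM.
apply/is_hermitianmxP; rewrite expr0 scale1r /range_proj trmxK.
by rewrite -/Q -[in LHS]QE map_trmx trmxK.
Qed.

End Defs.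

(* Main.v *)
(* Both (a) and (b) say that the trace norm of [rho - X] is at least [1] for all
   [X] in the cone.  The trace norm of a Hermitian [H] is at least
   [Tr ((2 P - 1) H)], and for [H = rho - X] this is [1 + Tr X - 2 Tr (P X)];
   so (c) implies (a).  Conversely, let [Q = 1 - P].  As [P sigma P <= k rho]
   for some [k], for every [v > 0] and all small [t > 0] the matrix
   [rho - t sigma] is the difference of the positive semidefinite matrices
   [rho - t sigma + A] and [A = t (1 + v^2) Q sigma Q].  Its trace norm is thus
   at most [1 - t + 2 t (1 + v^2) Tr (Q sigma)], and (a) gives
   [Tr (Q sigma) >= 1/2] as [v] tends to [0]. *)
Require Import Defs.
From HB Require Import structures.
From mathcomp Require Import all_boot all_order all_algebra.
From mathcomp Require Import all_classical all_reals all_analysis.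
From mathcomp Require Import complex.
From mathcomp Require Import sesquilinear spectral ring lra.

Local Open Scope classical_set_scope.
Local Open Scope ring_scope.

Set Implicit Arguments.
Unset Strict Implicit.
Unset Printing Implicit Defensive.

Import Order.TTheory GRing.Theory Num.Theory.

Local Open Scope sesquilinear_scope.
Local Open Scope complex_scope.

(** * Positive semidefinite matrices: spectral form, factorization, domination *)

Section PositiveSemidefinite.
Variable (R : realType).
Local Notation C := R[i].

Lemma adjmxM m n p (A : 'M[C]_(m, n)) (B : 'M[C]_(n, p)) :
  (A *m B)^t* = B^t* *m A^t*.
Proof. by rewrite trmx_mul map_mxM. Qed.

Lemma adjmxB m n (A B : 'M[C]_(m, n)) : (A - B)^t* = A^t* - B^t*.
Proof. by rewrite linearB map_mxB. Qed.

Lemma adjmxZ_real m n (c : C) (A : 'M[C]_(m, n)) :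
  c \is Num.real -> (c *: A)^t* = c *: A^t*.
Proof. by move=> /CrealP cR; rewrite linearZ map_mxZ /= cR. Qed.

Lemma adjmx_diag n (d : 'rV[C]_n) : (forall i, d 0 i \is Num.real) ->
  (diag_mx d)^t* = diag_mx d.
Proof.
move=> dR; rewrite tr_diag_mx map_diag_mx; congr diag_mx.
by apply/rowP => i; rewrite mxE; apply/CrealP.
Qed.

Lemma hermP n (A : 'M[C]_n) : A \is hermsymmx <-> A^t* = A.
Proof.
split=> [/is_hermitianmxP|AA]; first by rewrite expr0 scale1r => <-.
by apply/is_hermitianmxP; rewrite expr0 scale1r AA.
Qed.

Lemma psd_herm n (A : 'M[C]_n) : psd A -> A^t* = A.
Proof. by case=> /hermP. Qed.

Lemma form_mulmx n (A S : 'M[C]_n) (v : 'cV[C]_n) :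
  v^t* *m (S^t* *m A *m S) *m v = (S *m v)^t* *m A *m (S *m v).
Proof. by rewrite adjmxM !mulmxA. Qed.

Lemma psd_conj n (A S : 'M[C]_n) : psd A -> psd (S^t* *m A *m S).
Proof.
move=> [/hermP hA pA]; split=> [|v]; last by rewrite form_mulmx.
by apply/hermP; rewrite !adjmxM trmxCK hA mulmxA.
Qed.

Lemma psdD n (A B : 'M[C]_n) : psd A -> psd B -> psd (A + B).
Proof.
move=> [/hermP hA pA] [/hermP hB pB]; split=> [|v].
  by apply/hermP; rewrite linearD map_mxD hA hB.
by rewrite mulmxDr mulmxDl mxE addr_ge0.
Qed.

Lemma psdZ n (c : C) (A : 'M[C]_n) : 0 <= c -> psd A -> psd (c *: A).
Proof.
move=> c0 [/hermP hA pA]; split=> [|v].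
  by apply/hermP; rewrite adjmxZ_real ?hA ?ger0_real.
by rewrite -scalemxAr -scalemxAl mxE mulr_ge0.
Qed.

Lemma psd_diag n (d : 'rV[C]_n) : (forall i, 0 <= d 0 i) -> psd (diag_mx d).
Proof.
move=> d0; split=> [|v].
  by apply/hermP/adjmx_diag => i; apply: ger0_real.
rewrite mul_mx_diag mxE sumr_ge0 // => i _; rewrite !mxE mulrAC.
by rewrite mulr_ge0 // mulrC mul_conjC_ge0.
Qed.

Lemma psd0 n : psd (0 : 'M[C]_n).
Proof.
by rewrite -(raddf0 (@diag_mx C n)); apply: psd_diag => i; rewrite mxE.
Qed.

Lemma psd_proj n (P : 'M[C]_n) : P^t* = P -> P *m P = P -> psd P.
Proof.
move=> hP PP.
suff : psd (P^t* *m 1%:M *m P) by rewrite mulmx1 hP PP.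
by apply: psd_conj; rewrite -diag_const_mx; apply: psd_diag => i; rewrite mxE.
Qed.

Lemma projC n (P : 'M[C]_n) : P^t* = P -> P *m P = P ->
  (1%:M - P)^t* = 1%:M - P /\ (1%:M - P) *m (1%:M - P) = 1%:M - P.
Proof.
move=> hP PP; rewrite adjmxB trmx1 map_mx1 hP; split=> //.
by rewrite mulmxBr mulmx1 mulmxBl mul1mx PP subrr subr0.
Qed.

Lemma psd_diag_ge0 n (A : 'M[C]_n) i : psd A -> 0 <= A i i.
Proof.
move=> [_ /(_ (delta_mx i 0))].
by rewrite -map_trmx map_delta_mx trmx_delta -rowE -colE !mxE.
Qed.

Lemma psd_tr_ge0 n (A : 'M[C]_n) : psd A -> 0 <= \tr A.
Proof. by move=> pA; apply: sumr_ge0 => i _; apply: psd_diag_ge0. Qed.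

Lemma herm_spectral n (A : 'M[C]_n) : A^t* = A ->
  exists (U : 'M[C]_n) (d : 'rV[C]_n), [/\ U *m U^t* = 1%:M, U^t* *m U = 1%:M,
     forall i, d 0 i \is Num.real & A = U^t* *m diag_mx d *m U].
Proof.
move=> /hermP hA; have uU := spectral_unitarymx A.
exists (spectralmx A), (spectral_diag A); split.
- exact/unitarymxP.
- exact/mulmx1C/unitarymxP.
- by move=> i; have /mxOverP := hermitian_spectral_diag_real hA; apply.
- by rewrite -(invmx_unitary uU); apply/orthomx_spectralP/hermitian_normalmx.
Qed.

Lemma unitary_conjK n (U A B : 'M[C]_n) : U *m U^t* = 1%:M ->
  A = U^t* *m B *m U -> B = U *m A *m U^t*.
Proof.
by move=> UU ->; rewrite -!mulmxA UU mulmx1 !mulmxA UU mul1mx.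
Qed.

Lemma psd_spectral n (A : 'M[C]_n) : psd A ->
  exists (U : 'M[C]_n) (d : 'rV[C]_n), [/\ U *m U^t* = 1%:M, U^t* *m U = 1%:M,
     forall i, 0 <= d 0 i & A = U^t* *m diag_mx d *m U].
Proof.
move=> pA; have [U [d [UU UU' dR AE]]] := herm_spectral (psd_herm pA).
exists U, d; split=> // i.
(* The eigenvalues are the diagonal entries of [A] conjugated by the unitary. *)
have := psd_diag_ge0 i (psd_conj (U^t*) pA).
by rewrite trmxCK -(unitary_conjK UU AE) mxE eqxx.
Qed.

Lemma psd_factor n (A : 'M[C]_n) : psd A -> exists S : 'M[C]_n, A = S^t* *m S.
Proof.
move=> /psd_spectral[U [d [_ _ d0 ->]]].
pose s := \row_i sqrtC (d 0 i); exists (diag_mx s *m U).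
rewrite adjmxM adjmx_diag => [|i]; last by rewrite mxE ger0_real ?sqrtC_ge0.
rewrite !mulmxA -[_ *m _ *m diag_mx s]mulmxA mulmx_diag.
suff -> : \row_j (s 0 j * s 0 j) = d by [].
by apply/rowP => i; rewrite !mxE -expr2 sqrtCK.
Qed.

(** Nonnegative eigenvalues are each bounded by their sum. *)
Lemma psd_le_tr n (A : 'M[C]_n) : psd A -> psd ((\tr A)%:M - A).
Proof.
move=> /psd_spectral[U [d [UU UU' d0 ->]]].
rewrite -mulmxA mxtrace_mulC -mulmxA UU mulmx1 mxtrace_diag.
set t := \sum_i _.
suff : psd (U^t* *m diag_mx (const_mx t - d) *m U).
  rewrite raddfB /= diag_const_mx mulmxBr mulmxBl mulmxA.
  by rewrite mul_mx_scalar -scalemxAl UU' scalemx1.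
apply/psd_conj/psd_diag => i; rewrite !mxE subr_ge0 /t (bigD1 i) //=.
by rewrite lerDl sumr_ge0.
Qed.

(** Write [A = S^t* *m S]. The inner matrix [S *m N *m S^t*] is at most its trace times the
    identity, that trace is [\tr (A *m N)], and conjugating by [S] restores [A] on both sides. *)
Lemma psd_sandwich_le n (A N : 'M[C]_n) : psd A -> psd N ->
  psd (\tr (A *m N) *: A - A *m N *m A).
Proof.
move=> /psd_factor[S ->] pN.
have := psd_conj S (psd_le_tr (psd_conj (S^t*) pN)).
have <- : \tr (S^t* *m S *m N) = \tr (S^t*^t* *m N *m S^t*).
  by rewrite trmxCK [RHS]mxtrace_mulC mulmxA.
by rewrite trmxCK mulmxBr mulmxBl mul_mx_scalar -scalemxAl !mulmxA.
Qed.

Lemma psd_mxtrace_mul_ge0 n (A B : 'M[C]_n) : psd A -> psd B ->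
  0 <= \tr (A *m B).
Proof.
move=> /psd_factor[S ->] pB; rewrite -mulmxA mxtrace_mulC.
by have := psd_tr_ge0 (psd_conj (S^t*) pB); rewrite trmxCK.
Qed.

End PositiveSemidefinite.

(** * The trace norm of Hermitian matrices *)

Section TraceNorm.
Variable (R : realType).
Local Notation C := R[i].

Lemma char_poly_spectral n (U : 'M[C]_n) (d : 'rV[C]_n) : U *m U^t* = 1%:M ->
  char_poly (U^t* *m diag_mx d *m U) =
  \prod_(x <- [seq d 0 i | i <- enum 'I_n]) ('X - x%:P).
Proof.
move=> UU.
have -> : char_poly (U^t* *m diag_mx d *m U) = char_poly (diag_mx d).
  rewrite /char_poly /char_poly_mx !map_mxM.
  set V := map_mx _ U; set W := map_mx _ (U^t*).
  have VW : V *m W = 1%:M by rewrite -map_mxM UU map_mx1.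
  have -> : 'X%:M - W *m map_mx polyC (diag_mx d) *m V
     = W *m ('X%:M - map_mx polyC (diag_mx d)) *m V.
    by rewrite mulmxBr mulmxBl mul_mx_scalar -scalemxAl (mulmx1C VW) scalemx1.
  by rewrite !det_mulmx mulrAC -det_mulmx (mulmx1C VW) det1 mul1r.
rewrite char_poly_trig ?diag_mx_is_trig // big_map big_enum /=.
by apply: eq_bigr => i _; rewrite mxE eqxx.
Qed.

(** Frees the trace norm from the diagonalization chosen in its definition: [U] also diagonalizes
    [H^t* *m H], with entries [d 0 i ^+ 2], and equality of characteristic polynomials makes the two
    eigenvalue lists permutations of each other. *)
Lemma trnorm_spectral n (H U : 'M[C]_n) (d : 'rV[C]_n) :
    U *m U^t* = 1%:M -> (forall i, d 0 i \is Num.real) ->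
    H = U^t* *m diag_mx d *m U ->
  (trnorm H)%:C = \sum_i `|d 0 i|.
Proof.
move=> UU dR HE.
pose e := \row_i d 0 i ^+ 2.
have HH : H^t* *m H = U^t* *m diag_mx e *m U.
  rewrite HE !adjmxM trmxCK adjmx_diag // -!mulmxA; congr (_ *m _).
  rewrite [U *m _]mulmxA UU mul1mx [LHS]mulmxA; congr (_ *m _).
  by rewrite mul_diag_mx; apply/matrixP => i j; rewrite !mxE mulrnAr.
have hHH : (H^t* *m H)^t* = H^t* *m H by rewrite adjmxM trmxCK.
have uV := spectral_unitarymx (H^t* *m H).
have EV : H^t* *m H = (spectralmx (H^t* *m H))^t* *m
    diag_mx (spectral_diag (H^t* *m H)) *m spectralmx (H^t* *m H).
  rewrite -(invmx_unitary uV); apply/orthomx_spectralP.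
  exact/hermitian_normalmx/hermP.
have /prod_XsubC_eq pe :
    \prod_(x <- [seq spectral_diag (H^t* *m H) 0 i | i <- enum 'I_n])
      ('X - x%:P) = \prod_(x <- [seq e 0 i | i <- enum 'I_n]) ('X - x%:P).
  rewrite -(char_poly_spectral _ (unitarymxP uV)) -EV.
  by rewrite HH char_poly_spectral.
rewrite /trnorm /singular_value.
have enumE (f : 'I_n -> C) (g : C -> R) :
    \sum_(x <- [seq f i | i <- enum 'I_n]) g x = \sum_i g (f i).
  by rewrite big_map big_enum.
rewrite -(enumE (spectral_diag (H^t* *m H) 0)
  (fun x => Num.sqrt (complex.Re x))).
rewrite (perm_big _ pe) enumE rmorph_sum /=.
apply: eq_bigr => i _; rewrite mxE.
have /complex_realP[x ->] := dR i.
by rewrite normc_def -(rmorphXn (real_complex R)) /= expr0n addr0.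
Qed.

(** In an eigenbasis of [A - B] each eigenvalue is a difference of diagonal entries of [A] and [B];
    these are nonnegative, so its modulus is at most their sum. *)
Lemma trnorm_le n (A B : 'M[C]_n) : psd A -> psd B ->
  (trnorm (A - B))%:C <= \tr A + \tr B.
Proof.
move=> pA pB.
have hH : (A - B)^t* = A - B by rewrite adjmxB !psd_herm.
have [U [d [UU UU' dR HE]]] := herm_spectral hH.
rewrite (trnorm_spectral UU dR HE).
have trU (X : 'M[C]_n) : \tr X = \sum_i (U *m X *m U^t*) i i.
  by rewrite -/(mxtrace _) mxtrace_mulC mulmxA UU' mul1mx.
rewrite (trU A) (trU B) -big_split ler_sum // => i _.
have -> : d 0 i = (U *m A *m U^t*) i i - (U *m B *m U^t*) i i.
  transitivity (diag_mx d i i); first by rewrite mxE eqxx.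
  rewrite (unitary_conjK UU HE) mulmxBr mulmxBl [LHS]mxE.
  by rewrite [X in _ + X = _]mxE.
have a0 := psd_diag_ge0 i (psd_conj (U^t*) pA).
have b0 := psd_diag_ge0 i (psd_conj (U^t*) pB).
rewrite !trmxCK in a0 b0.
by apply: le_trans (ler_normB _ _) _; rewrite (ger0_norm a0) (ger0_norm b0).
Qed.

(* Duality with the trace norm, tested against the reflection [2 P - 1]. *)
Lemma trnorm_ge n (H P : 'M[C]_n) : H^t* = H -> P^t* = P -> P *m P = P ->
  \tr (P *m H) *+ 2 - \tr H <= (trnorm H)%:C.
Proof.
move=> hH hP PP.
have [U [d [UU UU' dR HE]]] := herm_spectral hH.
rewrite (trnorm_spectral UU dR HE).
(* The projection seen in the eigenbasis of [H]: its diagonal lies in [0, 1], so the weights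
   [T i i *+ 2 - 1] have modulus at most 1. *)
pose T := U *m P *m U^t*.
have T0 i : 0 <= T i i.
  by have := psd_diag_ge0 i (psd_conj (U^t*) (psd_proj hP PP)); rewrite trmxCK.
have T1 i : T i i <= 1.
  have pQ : psd (1%:M - P) by have [hQ QQ] := projC hP PP; apply: psd_proj.
  have := psd_diag_ge0 i (psd_conj (U^t*) pQ).
  rewrite trmxCK mulmxBr mulmxBl mulmx1 UU [X in _ <= X]mxE.
  by rewrite [X in X + _]mxE [X in _ + X]mxE eqxx subr_ge0.
have -> : \tr (P *m H) = \sum_i T i i * d 0 i.
  rewrite HE !mulmxA mxtrace_mulC !mulmxA mul_mx_diag.
  by apply: eq_bigr => i _; rewrite mxE.
have -> : \tr H = \sum_i d 0 i.
  by rewrite HE mxtrace_mulC mulmxA UU mul1mx mxtrace_diag.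
rewrite -sumrMnl -sumrB ler_sum // => i _.
rewrite -mulrnAl -[X in _ - X]mul1r -mulrBl.
have TR : T i i *+ 2 - 1 \is Num.real.
  by rewrite rpredB ?rpredMn ?rpred1 // ger0_real.
apply: le_trans (real_ler_norm (rpredM TR (dR i))) _.
rewrite normrM ler_piMl // real_ler_norml //.
rewrite lerBrDl subrr mulrn_wge0 //= lerBlDr -mulr2n.
by rewrite lerMn2r T1.
Qed.

Lemma trnorm_psd n (A : 'M[C]_n) : psd A -> (trnorm A)%:C = \tr A.
Proof.
move=> pA; apply/le_anti/andP; split.
  by have := trnorm_le pA (psd0 R n); rewrite subr0 mxtrace0 addr0.
(* With the identity as projection, the lower bound is 2 Tr A - Tr A. *)
have := @trnorm_ge n A 1%:M (psd_herm pA) _ (mul1mx _).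
by rewrite trmx1 map_mx1 mul1mx mulr2n addrK; apply.
Qed.

End TraceNorm.

(** * Pinching along the range of rho, and the bound on small perturbations *)

Lemma pinching_identity (F : comNzRingType) n (P Q X : 'M[F]_n) (u v : F) :
    u * v = 1 -> P + Q = 1%:M ->
  (u *: P - v *: Q) *m X *m (u *: P - v *: Q) =
  (1 + u ^+ 2) *: (P *m X *m P) + (1 + v ^+ 2) *: (Q *m X *m Q) - X.
Proof.
move=> uv PQ.
(* Only the free-standing [X] is split into its four blocks; the identity is then linear in these
   blocks. *)
have {4}-> : X = P *m X *m P + P *m X *m Q + (Q *m X *m P + Q *m X *m Q).
  by rewrite -!mulmxDr PQ !mulmx1 -mulmxDl PQ mul1mx.
rewrite !mulmxBl !mulmxBr -!scalemxAl -!scalemxAr !scalerA.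
rewrite [v * u]mulrC uv.
move: (P *m X *m P) (P *m X *m Q) (Q *m X *m P) (Q *m X *m Q) => a b c d.
by apply/matrixP => i j; rewrite !mxE; ring.
Qed.

Section RangeProjection.
Variable (R : realType) (n : nat).
Local Notation C := R[i].
Implicit Types (A X P rho sigma : 'M[C]_n).

Lemma adj_range_proj A : (range_proj A)^t* = range_proj A.
Proof. exact/hermP/range_proj_herm. Qed.

Lemma range_proj_mul A : range_proj A *m A = A.
Proof.
by rewrite -[RHS]trmxK -(proj_ortho_id (submx_refl A^T)) trmx_mul trmxK.
Qed.

Lemma range_proj_factor A : exists M, range_proj A = A *m M.
Proof.
have /submxP[D PD] : ((range_proj A)^T <= A^T)%MS by rewrite range_proj_range.
by exists D^T; rewrite -[LHS]trmxK PD trmx_mul trmxK.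
Qed.

(** As [range_proj A] is Hermitian and of the form [A *m M], the pinched matrix is [A *m N *m A]
    with [N = M *m X *m M^t*], to which [psd_sandwich_le] applies. *)
Lemma psd_pinched_le A X : psd A -> psd X ->
  exists2 k : C, 0 <= k &
    psd (k *: A - range_proj A *m X *m range_proj A).
Proof.
move=> pA pX; have [M PE] := range_proj_factor A.
have pN : psd (M *m X *m M^t*) by have := psd_conj (M^t*) pX; rewrite trmxCK.
exists (\tr (A *m (M *m X *m M^t*))); first exact: psd_mxtrace_mul_ge0.
have := psd_sandwich_le pA pN.
rewrite -{2}adj_range_proj PE adjmxM (psd_herm pA).
by rewrite !mulmxA.
Qed.

(* Young's inequality for the off-diagonal blocks of [X]: the difference is
   [W X W] with [W = u P - v Q], whose cross terms have weight [u v = 1]. *)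
Lemma psd_pinching P X (u v : C) : P^t* = P -> P *m P = P -> psd X ->
    u \is Num.real -> v \is Num.real -> u * v = 1 ->
  let Q := 1%:M - P in
  psd ((1 + u ^+ 2) *: (P *m X *m P) + (1 + v ^+ 2) *: (Q *m X *m Q) - X).
Proof.
move=> hP PP pX uR vR uv Q; have [hQ QQ] := projC hP PP.
have := psd_conj (u *: P - v *: Q) pX.
have -> : (u *: P - v *: Q)^t* = u *: P - v *: Q.
  by rewrite adjmxB (adjmxZ_real P uR) (adjmxZ_real Q vR) hP hQ.
by rewrite (pinching_identity _ uv) // addrC subrK.
Qed.

Lemma trnorm_sub_le rho X (v : R) : psd rho -> psd X -> 0 < v ->
  exists2 t : R, 0 < t &
    (trnorm (rho - t%:C *: X))%:C <= \tr rho - t%:C * \tr X +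
      t%:C * ((1 + v%:C ^+ 2) * \tr ((1%:M - range_proj rho) *m X)) *+ 2.
Proof.
move=> prho pX v0; set P := range_proj rho; set Q := 1%:M - P.
have hP : P^t* = P := adj_range_proj rho.
have PP : P *m P = P := range_proj_idem rho.
have [hQ QQ] := projC hP PP.
have [k0 /[dup] k0_ge0 /ger0_real/complex_realP[k k0E]] :=
  psd_pinched_le prho pX.
rewrite {}k0E -/P in k0_ge0 *; rewrite ler0c in k0_ge0 => pk.
(* [u] is forced by the pinching condition [u * v = 1], and [t] is chosen so that t (1 + u^2) = 1 /
   (k + 1). Using k + 1 avoids dividing by a possibly zero k. *)
pose u := v^-1; pose t := ((k + 1) * (1 + u ^+ 2))^-1.
have k1 : 0 < k + 1 by rewrite ltr_wpDl.
have u1 : 0 < 1 + u ^+ 2 by rewrite ltr_pwDl ?sqr_ge0.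
have t0 : 0 < t by rewrite invr_gt0 mulr_gt0.
exists t => //.
have uR : u%:C \is Num.real by apply/complex_realP; exists u.
have vR : v%:C \is Num.real by apply/complex_realP; exists v.
have uv : u%:C * v%:C = 1 by rewrite -rmorphM mulVf ?gt_eqF.
have pW := psd_pinching hP PP pX uR vR uv; rewrite -/Q /= in pW.
pose A2 := (t%:C * (1 + v%:C ^+ 2)) *: (Q *m X *m Q).
have tC0 : 0 <= t%:C :> C by rewrite ler0c ltW.
have pA2 : psd A2.
  apply: psdZ; last by have := psd_conj Q pX; rewrite hQ.
  by rewrite mulr_ge0 // addr_ge0 // -rmorphXn ler0c sqr_ge0.
have trA2 : \tr A2 = t%:C * ((1 + v%:C ^+ 2) * \tr (Q *m X)).
  by rewrite mxtraceZ [\tr (_ *m Q)]mxtrace_mulC mulmxA QQ mulrA.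
have pA1 : psd (rho - t%:C *: X + A2).
  have k1C : 0 <= ((k + 1)^-1)%:C :> C by rewrite ler0c invr_ge0 ltW.
  (* The first summand is rho - P X P / (k + 1), the second is t times the pinching inequality; by
     the choice of [t] the P X P terms cancel. *)
  have := psdD (psdZ k1C (psdD pk prho)) (psdZ tC0 pW).
  congr psd; rewrite /A2.
  move: (P *m X *m P) (Q *m X *m Q) => a d.
  have tE : ((k + 1)^-1)%:C = t%:C * (1 + u%:C ^+ 2) :> C.
    rewrite -rmorphXn -(rmorph1 (real_complex R)) -rmorphD -rmorphM.
    by congr (_%:C); rewrite /t invfM -mulrA mulVf ?mulr1 ?gt_eqF.
  have kE : ((k + 1)^-1)%:C * k%:C + ((k + 1)^-1)%:C = 1 :> C.
    rewrite -rmorphM -rmorphD -[X in _ + X]mulr1 -mulrDr mulVf ?gt_eqF //.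
  apply/matrixP => i j; rewrite !mxE.
  rewrite [X in X + _ = _](_ : _ = rho i j - t%:C * (1 + u%:C ^+ 2) * a i j).
    by ring.
  rewrite -tE -[X in _ = X - _]mul1r -kE; ring.
have := trnorm_le pA1 pA2; rewrite addrK => /le_trans; apply.
by rewrite raddfD raddfB /= mxtraceZ trA2 mulr2n addrA.
Qed.

End RangeProjection.

(** * Reduction of (a) and (b) to a lower bound over the cone, and the equivalence *)

(** The point 0 of the cone already realizes the value 1, so 1 is the minimum as soon as it is a
    lower bound. *)
Lemma mod_trace_dist_eq1 (R : realType) n (C : set 'M[R[i]]_n) rho :
    C 0 -> trnorm rho = 1 ->
  mod_trace_dist C rho = 1 <-> (forall X, C X -> 1 <= trnorm (rho - X)).
Proof.
move=> C0 rho1; rewrite /mod_trace_dist; set S := [set _ | _ in C].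
split=> [|lb1].
  case: xgetP => [_ -> [_ lb] x1 X CX|_ /eqP].
    by rewrite -x1; apply: lb; exists X.
  (* Without a minimum the distance would be the default -1, which is not 1. *)
  by rewrite lt_eqF // (lt_trans (ltrN10 R)).
apply: xget_unique => [|y [[X CX <-] lb]].
  by split=> [|_ [X CX <-]]; [exists 0; rewrite ?subr0|exact: lb1].
apply/le_anti/andP; split; last exact: lb1.
by apply: lb; exists 0; rewrite ?subr0.
Qed.

(** Only negative multipliers matter, and the cone absorbs their size. For the others the sum stays
    positive semidefinite, so its trace norm is its trace, which does not decrease. *)
Lemma BJ_orthogonal_coneP (R : realType) n (C : set 'M[R[i]]_n) rho :
    C `<=` @psd R n -> (forall (t : R) A, 0 <= t -> C A -> C (t%:C *: A)) ->
    psd rho ->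
  (forall X, C X -> BJ_orthogonal rho X) <->
  (forall X, C X -> trnorm rho <= trnorm (rho - X)).
Proof.
move=> C_psd C_cone prho; split=> [BJ X CX|le_rho X CX l].
  by have := BJ X CX (- 1); rewrite rmorphN rmorph1 scaleN1r.
have [l0|l0] := leP 0 l; last first.
  rewrite -[l]opprK rmorphN scaleNr; apply: le_rho.
  by apply: C_cone => //; rewrite oppr_ge0 ltW.
have plX := C_psd _ (C_cone _ _ l0 CX).
rewrite -lecR (trnorm_psd prho) (trnorm_psd (psdD prho plX)) raddfD /=.
by rewrite lerDl psd_tr_ge0.
Qed.

Lemma half_le_of_lt_quadratic (R : realFieldType) (q : R) : 0 <= q ->
  (forall v, 0 < v -> 1 <= (1 + v ^+ 2) * q *+ 2) -> 1 / 2 <= q.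
Proof.
move=> q0 H; rewrite leNgt; apply/negP => q_lt.
(* In place of a limit, test v = 1/2 - q: then 2 q (1 + v^2) = (1 - 2 v) (1 + v^2) < 1. *)
have v0 : 0 < 1 / 2 - q by rewrite subr_gt0.
by have := H _ v0; rewrite mulr2n; nra.
Qed.

Theorem theorem7 (R : realType) (n : nat) (C : set 'M[R[i]]_n)
    (rho : 'M[R[i]]_n) (P : 'M[R[i]]_n)
    (C_psd : C `<=` @psd R n)
    (C_cone : closed_convex_cone C)
    (rho_state : mixed_state rho)
    (P_def : P = range_proj rho) :
  (mod_trace_dist C rho = 1 <->
     (forall X : 'M[R[i]]_n, C X -> BJ_orthogonal rho X)) /\
  ((forall X : 'M[R[i]]_n, C X -> BJ_orthogonal rho X) <->
     (forall sigma : 'M[R[i]]_n, C sigma -> mixed_state sigma ->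
        \tr (P *m sigma) <= 1 / 2)).
Proof.
have [[X0 CX0] _ _ coneC] := C_cone; have [prho trho] := rho_state.
have C0 : C 0 by have := coneC 0 X0 (lexx 0) CX0; rewrite rmorph0 scale0r.
have rho1 : trnorm rho = 1.
  by apply: (@complexI R); rewrite (trnorm_psd prho) trho rmorph1.
have hP : P^t* = P by rewrite P_def adj_range_proj.
have PP : P *m P = P by rewrite P_def range_proj_idem.
have pP := psd_proj hP PP.
have pQ : psd (1%:M - P) by have [hQ QQ] := projC hP PP; apply: psd_proj.
rewrite (BJ_orthogonal_coneP C_psd coneC prho) rho1.
split; first exact: mod_trace_dist_eq1.
split=> [lb sigma Csigma [psigma tsigma]|c X CX].
  have qE : \tr ((1%:M - P) *m sigma) = 1 - \tr (P *m sigma).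
    by rewrite mulmxBl mul1mx raddfB /= tsigma.
  have q0 := psd_mxtrace_mul_ge0 pQ psigma.
  have /ger0_real/complex_realP[q qq] := q0.
  have pE : \tr (P *m sigma) = (1 - q)%:C.
    by rewrite rmorphB rmorph1 /= -qq qE subKr.
  suff : 1 / 2 <= q.
    move=> hq; have -> : 1 / 2 = (1 / 2)%:C :> R[i].
      by rewrite rmorphM fmorphV rmorph1 rmorphMn rmorph1.
    by rewrite pE lecR; lra.
  apply: half_le_of_lt_quadratic => [|v v0]; first by rewrite -ler0c -qq.
  (* Together with [lb] at t sigma this gives 1 <= 1 - t + 2 t (1 + v^2) q, from which t > 0
     cancels. *)
  have [t t0] := trnorm_sub_le prho psigma v0.
  rewrite -P_def qq trho tsigma mulr1.
  have := lb _ (coneC _ _ (ltW t0) Csigma).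
  rewrite -lecR rmorph1 => /le_trans /[apply].
  rewrite -addrA lerDl addrC subr_ge0 -mulrnAr.
  rewrite -{1}[t%:C]mulr1 ler_pM2l ?ltcR //.
  rewrite -rmorphXn -(rmorph1 (real_complex R)) -rmorphD -rmorphM -rmorphMn /=.
  by rewrite lecR.
have pX := C_psd _ CX.
have hH : (rho - X)^t* = rho - X by rewrite adjmxB !psd_herm.
(* This is (c) made homogeneous: normalize [X] to trace 1. If the trace is 0, nonnegativity of Tr
   ((1 - P) X) gives Tr (P X) <= 0 directly. *)
have le_tr : \tr (P *m X) *+ 2 <= \tr X.
  have tX0 := psd_tr_ge0 pX.
  have [tX|tX] := eqVneq (\tr X) 0.
    have := psd_mxtrace_mul_ge0 pQ pX.
    rewrite mulmxBl mul1mx raddfB /= tX sub0r oppr_ge0 => PX0.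
    by rewrite pmulrn_lle0.
  have /complex_realP[x xE] := ger0_real tX0.
  have x0 : 0 < x by rewrite -ltcR -xE lt_neqAle eq_sym tX.
  have Vx : \tr ((x^-1)%:C *: X) = 1.
    by rewrite mxtraceZ xE -rmorphM mulVf ?gt_eqF // rmorph1.
  have Vx0 : 0 <= x^-1 by rewrite invr_ge0 ltW.
  have := c _ (coneC _ _ Vx0 CX) (conj (C_psd _ (coneC _ _ Vx0 CX)) Vx).
  rewrite -scalemxAr mxtraceZ ler_pdivlMr // -mulrA mulr_natr.
  by rewrite fmorphV /= -xE ler_pdivrMl ?mulr1 // xE ltcR.
rewrite -lecR rmorph1; apply: le_trans (trnorm_ge hH hP PP).
(* As P rho = rho has trace 1, the lower bound equals 1 + Tr X - 2 Tr (P X). *)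
rewrite mulmxBr !raddfB /= P_def range_proj_mul trho -P_def mulrnBl.
by rewrite opprK addrACA [2 - 1]addrK lerDl addrC subr_ge0.
Qed.
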